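(* Let $E$ be an arbitrary symmetric space on $I=[0,1]$ and let $M(E)$ be its multiplicator with respect to tensor product. Then $$\|\sigma_t\|_{M(E)\to M(E)}=\|\sigma_t\|_{E\to E}\qquad\text{for } 0<t\le 1,$$ and $$\|\sigma_{1/t}\|_{E\to E}^{-1}\le\|\sigma_t\|_{M(E)\to M(E)}\le\|\sigma_t\|_{E\to E}\qquad\text{for } t>1.$$
   Context: $I=[0,1]$ with Lebesgue measure $\mu$. For a measurable function $z$ on $I$ or $I\times I$, $n_z(\tau)=\mu\{w:|z(w)|>\tau\}$ ($\tau>0$) is the distribution function of $|z|$ (on $I\times I$, $\mu$ is two-dimensional Lebesgue measure); two functions are equimeasurable if their distribution functions coincide; $z^*$ is the left-continuous non-increasing rearrangement of $|z|$ on $(0,1]$. A symmetric space on $I$ is a nonzero Banach space $E$ of (classes of) measurable functions on $I$ such that: (a) $y\in E$ and $|x|\le|y|$ a.e. imply $x\in E$ and $\|x\|_E\le\|y\|_E$; (b) $y\in E$ and $x$ equimeasurable with $y$ imply $x\in E$ and $\|x\|_E=\|y\|_E$. $E(I\times I)$ denotes the space of measurable $z$ on $I\times I$ with $z^*\in E$, normed by $\|z\|_{E(I\times I)}=\|z^*\|_E$. For measurable $x,y$ on $I$, $(x\otimes y)(s,t)=x(s)y(t)$. The multiplicator $M(E)$ is the set of all measurable $x$ on $I$ such that $x\otimes y\in E(I\times I)$ for every $y\in E$, with norm $\|x\|_{M(E)}=\sup\{\|x\otimes y\|_{E(I\times I)}:\|y\|_E\le1\}$; it is a symmetric space on $I$.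 For $t>0$ the dilation operator is $\sigma_t y(u)=y(u/t)\chi_{[0,1]}(u/t)$, $u\in I$. *)

(* Defs.v *)
From HB Require Import structures.
From mathcomp Require Import all_boot all_order all_algebra.
From mathcomp Require Import all_classical all_reals all_analysis.

Set Implicit Arguments.
Unset Strict Implicit.
Unset Printing Implicit Defensive.

Import Order.TTheory GRing.Theory Num.Theory.
Import numFieldNormedType.Exports.

Local Open Scope classical_set_scope.
Local Open Scope ring_scope.

(* A function on I is a map R -> R of which only the values on I matter, and a
   function on I x I is a map R * R -> R.  Classes modulo equality a.e. are
   handled through representatives.  [lebesgue_measure] lives on the Borel
   sigma-algebra, so representatives are Borel; every Lebesgue measurable
   function is a.e. equal to such a representative. *)
Definition I01 {R : realType} : set R := `[0, 1].

Definition lebesgue2 {R : realType} :=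
  (@lebesgue_measure R \x @lebesgue_measure R)%E.

Definition distr_fun {d : measure_display} {T : measurableType d}
    {R : realType} (mu : set T -> \bar R) (D : set T) (z : T -> R) (tau : R)
    : \bar R :=
  mu (D `&` [set w | tau < `|z w|]).

Definition equimeasurable {R : realType} (x y : R -> R) : Prop :=
  forall tau, 0 < tau ->
    distr_fun lebesgue_measure I01 x tau = distr_fun lebesgue_measure I01 y tau.

(* z^*(u) = inf {tau > 0 : n_z(tau) < u}: the strict inequality gives the
   left-continuous version.  At u = 0 the set is empty and z^*(0) = 0, a value
   on a null set. *)
Definition rearrangement2 {R : realType} (z : R * R -> R) (u : R) : R :=
  inf [set tau | 0 < tau /\
    (distr_fun lebesgue2 (I01 `*` I01) z tau < u%:E)%E].

(* The Banach space of classes is given by the set of representatives together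
   with the norm read on representatives, which vanishes exactly on functions
   that are 0 a.e. on I. *)
Record symmetric_space (R : realType) := SymmetricSpace {
  ss_carrier : set (R -> R) ;
  ss_norm : (R -> R) -> R ;
  ss_measurable : forall x : R -> R, ss_carrier x -> measurable_fun I01 x ;
  ss_nonzero : exists2 x, ss_carrier x & ss_norm x != 0 ;
  ss_add : forall x y, ss_carrier x -> ss_carrier y ->
    ss_carrier (fun u => x u + y u) ;
  ss_scale : forall (a : R) x, ss_carrier x -> ss_carrier (fun u => a * x u) ;
  ss_norm_eq0 : forall x, ss_carrier x ->
    (ss_norm x = 0 <-> {ae lebesgue_measure, forall u : R, I01 u -> x u = 0}) ;
  ss_normZ : forall (a : R) x, ss_carrier x ->
    ss_norm (fun u => a * x u) = `|a| * ss_norm x ;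
  ss_normD : forall x y, ss_carrier x -> ss_carrier y ->
    ss_norm (fun u => x u + y u) <= ss_norm x + ss_norm y ;
  ss_complete : forall x_ : nat -> R -> R, (forall n, ss_carrier (x_ n)) ->
    (forall e : R, 0 < e -> exists N, forall m n, (N <= m)%N -> (N <= n)%N ->
      ss_norm (fun u => x_ m u - x_ n u) < e) ->
    exists2 x, ss_carrier x &
      ss_norm (fun u => x_ n u - x u) @[n --> \oo] --> (0 : R) ;
  ss_ideal : forall x y : R -> R, ss_carrier y -> measurable_fun I01 x ->
    {ae lebesgue_measure, forall u : R, I01 u -> `|x u| <= `|y u|} ->
    ss_carrier x /\ ss_norm x <= ss_norm y ;
  ss_symmetric : forall x y : R -> R, ss_carrier y -> measurable_fun I01 x ->
    equimeasurable x y -> ss_carrier x /\ ss_norm x = ss_norm y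
}.

Definition square_space {R : realType} (E : symmetric_space R)
    : set (R * R -> R) :=
  [set z | measurable_fun (I01 `*` I01) z /\ ss_carrier E (rearrangement2 z)].

Definition square_norm {R : realType} (E : symmetric_space R)
    (z : R * R -> R) : R :=
  ss_norm E (rearrangement2 z).

Definition tensor {R : realType} (x y : R -> R) (w : R * R) : R :=
  x w.1 * y w.2.

Definition multiplicator {R : realType} (E : symmetric_space R)
    : set (R -> R) :=
  [set x | measurable_fun I01 x /\
           forall y, ss_carrier E y -> square_space E (tensor x y)].

Definition multiplicator_norm {R : realType} (E : symmetric_space R)
    (x : R -> R) : \bar R :=
  ereal_sup [set (square_norm E (tensor x y))%:E
            | y in [set y | ss_carrier E y /\ ss_norm E y <= 1]].

Definition dilation {R : realType} (t : R) (y : R -> R) (u : R) : R :=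
  y (u / t) * \1_I01 (u / t).

(* The operator norm of T : A -> A for the norm N: the least bound C, and +oo
   when T does not map A to itself or is not bounded. *)
Definition operator_norm {R : realType} (A : set (R -> R))
    (N : (R -> R) -> \bar R) (T : (R -> R) -> (R -> R)) : \bar R :=
  ereal_inf [set C%:E | C in [set C : R | 0 <= C /\
    forall x, A x -> A (T x) /\ (N (T x) <= C%:E * N x)%E]].

Definition space_operator_norm {R : realType} (E : symmetric_space R)
    (T : (R -> R) -> (R -> R)) : \bar R :=
  operator_norm (ss_carrier E) (fun x => (ss_norm E x)%:E) T.

Definition multiplicator_operator_norm {R : realType} (E : symmetric_space R)
    (T : (R -> R) -> (R -> R)) : \bar R :=
  operator_norm (multiplicator E) (multiplicator_norm E) T.

(* Main.v *)
(** Write [n_z] for the distribution function of [z].  Since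
    [n_(σ_t x ⊗ y) <= min (1, t n_(x ⊗ y))], which is the distribution function
    of [σ_t ((x ⊗ y)^* )], every bound of [σ_t] on [E] is a bound of [σ_t] on
    [M(E)].  Conversely, let [1] be the constant function; it belongs to [M(E)]
    and has norm at most 1 there.  For [t <= 1], [σ_t 1 ⊗ y] and [σ_t y] are
    equimeasurable, so a bound of [σ_t] on [M(E)], applied to [1], bounds
    [σ_t] on [E].  For [t > 1], [σ_t σ_(1/t) 1 = 1] on [I], so the product of a
    bound of [σ_t] on [M(E)] and a bound of [σ_(1/t)] on [E] is at least 1. *)
Require Import Defs.
From HB Require Import structures.
From mathcomp Require Import all_boot all_order all_algebra.
From mathcomp Require Import all_classical all_reals all_analysis.
From mathcomp Require Import measurable_realfun lra.
Import Order.TTheory GRing.Theory Num.Theory.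
Local Open Scope ring_scope.

Section multiplicator_dilation.
Import numFieldNormedType.Exports.
Local Open Scope classical_set_scope.
Context {R : realType}.
Implicit Types (t tau u : R) (x y : R -> R) (z w : R * R -> R).

Local Notation mu := (@lebesgue_measure R).
Local Notation mu2 := (@lebesgue2 R).
Local Notation I2 := (@I01 R `*` @I01 R).

(** * Scaling of Lebesgue measure under dilation *)

Lemma measurable_divr t : measurable_fun setT (fun u : R => u / t).
Proof. exact: mulrr_measurable. Qed.

Lemma measurable_I01 : measurable (@I01 R).
Proof. exact: measurable_itv. Qed.

Lemma measurable_I2 : measurable I2.
Proof. by apply: measurableX; exact: measurable_I01. Qed.

(** By uniqueness of Lebesgue measure: [t^-1] times the pushforward of [mu] under [u / t] gives []a,
    b]] the measure [(b * t - a * t) / t], which is its length. *)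
Lemma lebesgue_measure_dilation t (A : set R) : 0 < t -> measurable A ->
  mu ((fun u => u / t) @^-1` A) = (t%:E * mu A)%E.
Proof.
move=> t0 mA.
have ti0 : 0 <= t^-1 by rewrite invr_ge0 ltW.
have mf : measurable_fun setT
    ((fun u => u / t) : measurableTypeR R -> measurableTypeR R).
  exact: measurable_divr.
pose m : {measure set (measurableTypeR R) -> \bar R} :=
  measure_function_pushforward__canonical__measure_function_Measure mu mf.
suff -> : mu A = mscale (NngNum ti0) m A.
  by rewrite /mscale/= muleA -EFinM divff ?gt_eqF// mul1e.
apply: lebesgue_measure_unique => // _ [[a b]] _ <-.
change (mu `]a, b] = ((t^-1)%:E * mu ((fun u => (u / t)%R) @^-1` `]a, b]))%E).
have -> : (fun u => u / t) @^-1` `]a, b] = `](a * t), (b * t)]%classic.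
  by apply/seteqP; split => u /=; rewrite !in_itv/= ltr_pdivlMr// ler_pdivrMr.
rewrite !lebesgue_measure_itv/= !lte_fin ltr_pM2r//.
case: ifP => _; last by rewrite mule0.
by rewrite -!EFinD -EFinM -mulrBl mulrCA mulVf ?mulr1// gt_eqF.
Qed.

(** The same argument, now by uniqueness of the product measure: on rectangles only the first side
    is stretched, and the one-dimensional case applies to it. *)
Lemma lebesgue2_dilation t (A : set (R * R)) : 0 < t -> measurable A ->
  mu2 ((fun v => (v.1 / t, v.2)) @^-1` A) = (t%:E * mu2 A)%E.
Proof.
move=> t0 mA.
have ti0 : 0 <= t^-1 by rewrite invr_ge0 ltW.
pose T := measurableTypeR R.
have mf : measurable_fun setT ((fun v => (v.1 / t, v.2)) : T * T -> T * T).
  apply: measurable_fun_pair; last exact: measurable_snd.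
  by apply: (measurableT_comp (measurable_divr t)); exact: measurable_fst.
pose m : {measure set (T * T) -> \bar R} :=
  measure_function_pushforward__canonical__measure_function_Measure
    (mu \x mu)%E mf.
suff -> : mu2 A = mscale (NngNum ti0) m A.
  by rewrite /mscale/= muleA -EFinM divff ?gt_eqF// mul1e.
apply: (@product_measure_unique _ _ _ _ R mu mu (mscale (NngNum ti0) m)) => //.
move=> B C mB mC.
change ((t^-1)%:E * mu2 ((fun v => (v.1 / t, v.2)%R) @^-1` (B `*` C)) =
  mu B * mu C)%E.
have -> : (fun v : R * R => (v.1 / t, v.2)) @^-1` (B `*` C) =
  ((fun u => u / t) @^-1` B) `*` C by [].
rewrite /lebesgue2 product_measure1E//; last first.
  by rewrite -[X in measurable X]setTI; apply: measurable_divr.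
have := lebesgue_measure_dilation t B t0 mB => /= ->.
by rewrite muleA muleA -EFinM mulVf ?gt_eqF// mul1e.
Qed.

(** * Distribution functions on a general measure space *)

Lemma measurable_suplevel {d} {T : measurableType d} (D : set T) (z : T -> R)
  tau : measurable D -> measurable_fun D z ->
  measurable (D `&` [set v | tau < `|z v|]).
Proof.
move=> mD mz.
have mnz : measurable_fun D (fun v => `|z v|) by exact: measurableT_comp.
have -> : [set v | tau < `|z v|] = (fun v => `|z v|) @^-1` `]tau, +oo[.
  by apply/seteqP; split => v /=; rewrite in_itv/= andbT.
by apply: mnz => //; exact: measurable_itv.
Qed.

Section distribution_function.
Context {d : measure_display} {T : measurableType d}.
Variables (m : {measure set T -> \bar R}) (D : set T) (z : T -> R).
Hypotheses (mD : measurable D) (mz : measurable_fun D z).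

Let n := distr_fun m D z.

Lemma distr_fun_ge0 tau : (0 <= n tau)%E.
Proof. exact: measure_ge0. Qed.

Lemma distr_fun_le_measure tau : (n tau <= m D)%E.
Proof.
apply: le_measure; rewrite ?inE; [exact: measurable_suplevel|exact: mD|].
exact: subIsetl.
Qed.

Lemma distr_fun_le tau tau' : tau <= tau' -> (n tau' <= n tau)%E.
Proof.
move=> tt; apply: le_measure; rewrite ?inE; [exact: measurable_suplevel..|].
by apply: setIS => v /=; exact: le_lt_trans.
Qed.

(** Right-continuity in the form used below: the sets where [|z|] exceeds [tau + 1/(k+1)] increase
    to the set where it exceeds [tau], and measure is continuous from below. *)
Lemma distr_fun_rcont tau (a : \bar R) : (a < n tau)%E ->
  exists2 tau', tau < tau' & (a < n tau')%E.
Proof.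
move=> ltan.
pose F k := D `&` [set v | tau + k.+1%:R^-1 < `|z v|].
have FE : \bigcup_k F k = D `&` [set v | tau < `|z v|].
  apply/seteqP; split => [v [k _] [Dv /= h]|v [Dv /= h]].
    by split => //=; apply: lt_trans h; rewrite ltrDl invr_gt0.
  have e0 : 0 < `|z v| - tau by rewrite subr_gt0.
  have [k _ /(_ k (leqnn _))] := near_infty_natSinv_lt (PosNum e0).
  by move=> /= hk; exists k => //; split => //=; rewrite -ltrBrDl.
have mF k : measurable (F k) by exact: measurable_suplevel.
have ndF : nondecreasing_seq F.
  move=> i j ij; apply/subsetPset; apply: setIS => v /=; apply: le_lt_trans.
  by rewrite lerD2l lef_pV2 ?posrE// ler_nat.
have /(nondecreasing_cvg_mu mF) : measurable (\bigcup_k F k).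
  by rewrite FE; exact: measurable_suplevel.
move=> /(_ R m ndF) cF.
apply: contrapT => h.
have : (n tau <= a)%E; last by rewrite leNgt ltan.
rewrite /n /distr_fun -FE.
apply: (cvge_le _ cF); near=> k; rewrite leNgt; apply/negP => hk; apply: h.
by exists (tau + k.+1%:R^-1) => //; rewrite ltrDl invr_gt0.
Unshelve. all: by end_near. Qed.

(** As [z] is finite everywhere, the sets where [|z| > k+1] decrease to the empty set, and on a
    domain of finite measure their measures tend to 0. This makes the set in the definition of
    [rearrangement2] nonempty. *)
Lemma distr_fun_lt (a : \bar R) : (m D < +oo)%E -> (0 < a)%E ->
  exists2 tau, 0 < tau & (n tau < a)%E.
Proof.
move=> mDoo a0.
pose F k := D `&` [set v | k.+1%:R < `|z v|].
have FE : \bigcap_k F k = set0.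
  apply/seteqP; split => // v /= h.
  have [_] := h (Num.truncn `|z v|) I.
  by apply/negP; rewrite -leNgt ltW// truncnS_gt.
have mF k : measurable (F k) by exact: measurable_suplevel.
have niF : nonincreasing_seq F.
  move=> i j ij; apply/subsetPset; apply: setIS => v /=; apply: le_lt_trans.
  by rewrite ler_nat.
have F0 : (m (F 0%N) < +oo)%E by exact: le_lt_trans (distr_fun_le_measure _) mDoo.
have /(nonincreasing_cvg_mu F0 mF) : measurable (\bigcap_k F k) by rewrite FE.
move=> /(_ niF); rewrite FE measure0 => cF.
apply: contrapT => h.
suff : (a <= 0)%E by rewrite leNgt a0.
apply: (cvge_ge _ cF); near=> k; rewrite leNgt; apply/negP => hk; apply: h.
by exists k.+1%:R.
Unshelve. all: by end_near. Qed.

End distribution_function.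

(** * The rearrangement and its distribution function *)

Local Notation n1 := (distr_fun mu (@I01 R)).
Local Notation n2 := (distr_fun mu2 I2).

Lemma lebesgue_measure_I01 : mu (@I01 R) = 1%E.
Proof. by rewrite lebesgue_measure_itv/= lte01 oppr0 adde0. Qed.

Lemma lebesgue2_I2 : mu2 I2 = 1%E.
Proof.
rewrite /lebesgue2 product_measure1E; [|exact: measurable_I01..].
by change (mu I01 * mu I01 = 1)%E; rewrite lebesgue_measure_I01 mule1.
Qed.

Lemma distr_fun2_ge0 z tau : (0 <= n2 z tau)%E.
Proof. exact: (distr_fun_ge0 (mu \x mu)%E). Qed.

Lemma distr_fun2_le1 z tau : measurable_fun I2 z -> (n2 z tau <= 1)%E.
Proof.
move=> mz; rewrite -lebesgue2_I2.
exact: (distr_fun_le_measure (mu \x mu)%E _ _ measurable_I2 mz).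
Qed.

Lemma rearrangement2_set_nonempty z u : measurable_fun I2 z -> 0 < u ->
  [set tau | 0 < tau /\ (n2 z tau < u%:E)%E] !=set0.
Proof.
move=> mz u0.
have [||tau tau0 h] := @distr_fun_lt _ _ (mu \x mu)%E I2 z measurable_I2 mz u%:E.
- by change (mu2 I2 < +oo)%E; rewrite lebesgue2_I2 ltry.
- by rewrite lte_fin.
- by exists tau.
Qed.

Lemma rearrangement2_eq0 z u : u <= 0 -> rearrangement2 z u = 0.
Proof.
move=> u0; rewrite /rearrangement2.
rewrite (_ : [set tau | _] = set0) ?inf0//.
apply/seteqP; split => // tau [_]/=.
by rewrite ltNge (le_trans _ (distr_fun2_ge0 z tau))// lee_fin.
Qed.

Lemma rearrangement2_ge0 z u : 0 <= rearrangement2 z u.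
Proof.
rewrite /rearrangement2; set S := [set tau | _].
have [->|h] := eqVneq S set0; first by rewrite inf0.
by apply: lb_le_inf; [exact/set0P|move=> tau [/ltW]].
Qed.

Lemma rearrangement2_le z w u : measurable_fun I2 w ->
  (forall tau, 0 < tau -> (n2 z tau <= n2 w tau)%E) ->
  rearrangement2 z u <= rearrangement2 w u.
Proof.
move=> mw zw; have [u0|u0] := leP u 0; first by rewrite !rearrangement2_eq0.
apply: lb_le_inf; first exact: rearrangement2_set_nonempty.
move=> tau [tau0 h]; apply: ge_inf; first by exists 0 => s [/ltW].
by split => //; exact: le_lt_trans (zw _ tau0) h.
Qed.

Lemma rearrangement2_nonincreasing z u v : measurable_fun I2 z -> 0 < u ->
  u <= v -> rearrangement2 z v <= rearrangement2 z u.
Proof.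
move=> mz u0 uv; apply: lb_le_inf; first exact: rearrangement2_set_nonempty.
move=> tau [tau0 h]; apply: ge_inf; first by exists 0 => s [/ltW].
by split => //; apply: lt_le_trans h _; rewrite lee_fin.
Qed.

Lemma measurable_rearrangement2 z : measurable_fun I2 z ->
  measurable_fun I01 (rearrangement2 z).
Proof.
move=> mz.
(* The point 0 is split off because the default value 0 of the rearrangement there breaks
   monotonicity. On []0, 1]] the sets where it is at least [r] are intervals. *)
have -> : @I01 R = [set 0] `|` `]0, 1].
  by rewrite /I01 -(@setU1itv _ _ _ _ false)// bnd_simp ler01.
apply/measurable_funU => //; split; first exact: measurable_fun_set1.
apply: (measurability (@RGenCInfty.G R)) => [|/= _ [_] [r] -> <-].
  exact: RGenCInfty.measurableE.
apply: is_interval_measurable => s t/=.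
rewrite !in_itv/= !andbT => -[/andP[s0 s1] rs] [/andP[t0 t1] rt] u /andP[su ut].
have u0 : 0 < u := lt_le_trans s0 su.
rewrite !in_itv/= andbT u0 (le_trans ut)//; split => //.
by rewrite (le_trans rt)// rearrangement2_nonincreasing.
Qed.

(** The inequality is strict by right-continuity: the distribution function still exceeds [u] at
    some [s > tau], and this [s] is a lower bound of the set whose infimum is taken. *)
Lemma lt_rearrangement2 z u tau : measurable_fun I2 z -> 0 < u ->
  (u%:E < n2 z tau)%E -> tau < rearrangement2 z u.
Proof.
move=> mz u0 /(distr_fun_rcont (mu \x mu)%E _ _ measurable_I2 mz)[s ts us].
apply: (lt_le_trans ts); apply: lb_le_inf.
  exact: rearrangement2_set_nonempty.
move=> r [r0 h]; rewrite leNgt; apply/negP => rs.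
have := distr_fun_le (mu \x mu)%E _ _ measurable_I2 mz _ _ (ltW rs).
by rewrite leNgt (lt_trans _ us).
Qed.

Lemma rearrangement2_gt z u tau : 0 < tau -> tau < rearrangement2 z u ->
  (u%:E <= n2 z tau)%E.
Proof.
move=> tau0 h; rewrite leNgt; apply/negP => lt; move: h; apply/negP.
by rewrite -leNgt; apply: ge_inf => //; exists 0 => s [/ltW].
Qed.

Lemma suplevel_rearrangement2_itv z tau : measurable_fun I2 z ->
  `]0, fine (n2 z tau)[ `<=` I01 `&` [set u | tau < `|rearrangement2 z u|].
Proof.
move=> mz u /=; rewrite in_itv/= => /andP[u0 un].
have [n0 nle] := (distr_fun2_ge0 z tau, distr_fun2_le1 z tau mz).
have nf : (n2 z tau) \is a fin_num by rewrite ge0_fin_numE// (le_lt_trans nle) ?ltry.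
have un' : (u%:E < n2 z tau)%E by rewrite -(fineK nf) lte_fin.
split.
  rewrite /I01/= in_itv/= ltW//= -lee_fin.
  by apply: le_trans nle; exact: ltW.
by rewrite /= ger0_norm ?rearrangement2_ge0// lt_rearrangement2.
Qed.

(** With [r] the value of the distribution function of [z] at [tau], the set where the rearrangement
    exceeds [tau] lies between []0, r[] and [[0, r]], which both have measure [r]. *)
Lemma distr_fun_rearrangement2 z tau : measurable_fun I2 z -> 0 < tau ->
  n1 (rearrangement2 z) tau = n2 z tau.
Proof.
move=> mz tau0.
have [n0 nle] := (distr_fun2_ge0 z tau, distr_fun2_le1 z tau mz).
have nf : (n2 z tau) \is a fin_num by rewrite ge0_fin_numE// (le_lt_trans nle) ?ltry.
have ms := measurable_suplevel _ _ tau measurable_I01 (measurable_rearrangement2 z mz).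
have r0 : 0 <= fine (n2 z tau) by exact: fine_ge0.
apply/eqP; rewrite eq_le; apply/andP; split.
  apply: (@le_trans _ _ (mu `[0, fine (n2 z tau)])).
    apply: le_measure; rewrite ?inE; [exact: ms|exact: measurable_itv|].
    move=> u [/=]; rewrite /I01/= !in_itv/= => /andP[u0 _].
    rewrite u0/= ger0_norm ?rearrangement2_ge0// => /(rearrangement2_gt _ _ _ tau0).
    by rewrite -lee_fin fineK.
  rewrite lebesgue_measure_itv/= lte_fin oppr0 adde0 fineK//.
  by case: ifP.
apply: (@le_trans _ _ (mu `]0, fine (n2 z tau)[)).
  rewrite lebesgue_measure_itv/= lte_fin oppr0 adde0 fineK//.
  have [//|] := ltP 0 (fine (n2 z tau)).
  by rewrite -lee_fin fineK.
apply: le_measure; rewrite ?inE; [exact: measurable_itv|exact: ms|].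
exact: suplevel_rearrangement2_itv.
Qed.

(** * Distribution functions of dilations and tensor products *)

Lemma measurable_dilation t y : measurable_fun I01 y ->
  measurable_fun I01 (dilation t y).
Proof.
move=> my; apply: measurable_funTS.
have -> : dilation t y = (y \_ I01) \o (fun u => u / t).
  apply/funext => u; rewrite /dilation /= patchE indicE.
  by case: ifP => _; rewrite ?mulr1 ?mulr0.
apply: measurableT_comp; last exact: measurable_divr.
exact: (measurable_restrictT y measurable_I01).1.
Qed.

Lemma measurable_tensor x y : measurable_fun I01 x -> measurable_fun I01 y ->
  measurable_fun I2 (tensor x y).
Proof.
move=> mx my; apply: measurable_funM.
  apply: (measurable_comp measurable_I01) => //.
    by move=> _ [v [? ?] <-].
  by apply: measurable_funTS; exact: measurable_fst.
apply: (measurable_comp measurable_I01) => //.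
  by move=> _ [v [? ?] <-].
by apply: measurable_funTS; exact: measurable_snd.
Qed.

(** Where [x] is an indicator, the superlevel set of the tensor product is a rectangle with sides
    [A] and the superlevel set of [y]. *)
Lemma distr_fun_tensor_indic (A : set R) x y tau : measurable A ->
  A `<=` I01 -> (forall s, I01 s -> x s = \1_A s) ->
  measurable_fun I01 y -> 0 < tau ->
  n2 (tensor x y) tau = (mu A * n1 y tau)%E.
Proof.
move=> mA AI xA my tau0; rewrite /distr_fun.
rewrite (_ : _ `&` _ = A `*` (I01 `&` [set u | tau < `|y u|])); last first.
  apply/seteqP; split => -[s u] /=.
    move=> [[Is Iu]]; rewrite /tensor/= xA// indicE.
    have [/set_mem As|_] := boolP (s \in A); first by rewrite mul1r.
    by rewrite mul0r normr0 ltNge ltW.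
  move=> [As [Iu h]]; split; first by split => //; exact: AI.
  by rewrite /tensor/= xA; [rewrite indicE mem_set// mul1r|exact: AI].
rewrite /lebesgue2 product_measure1E//.
exact: (measurable_suplevel _ _ tau measurable_I01 my).
Qed.

Lemma suplevel_dilation t y tau : 0 < tau ->
  [set u | tau < `|dilation t y u|] =
  (fun u => u / t) @^-1` (I01 `&` [set u | tau < `|y u|]).
Proof.
move=> tau0; apply/seteqP; split => u /=; rewrite /dilation indicE.
  have [/set_mem Iu|_] := boolP (u / t \in I01); first by rewrite mulr1.
  by rewrite mulr0 normr0 ltNge ltW.
by move=> [Iu h]; rewrite mem_set// mulr1.
Qed.

(** For [t <= 1] the stretched superlevel set stays inside [[0, t]], so intersecting it with [I01]
    loses nothing and equality holds. *)
Lemma distr_fun_dilation t y tau : 0 < t <= 1 -> 0 < tau ->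
  measurable_fun I01 y -> n1 (dilation t y) tau = (t%:E * n1 y tau)%E.
Proof.
move=> /andP[t0 t1] tau0 my.
rewrite /distr_fun suplevel_dilation// setIidr; last first.
  move=> u []; rewrite /I01/= !in_itv/= => /andP[u0 u1] _.
  rewrite ler_pdivlMr// mul0r in u0; rewrite ler_pdivrMr// mul1r in u1.
  by rewrite u0 (le_trans u1).
rewrite lebesgue_measure_dilation//.
exact: (measurable_suplevel _ _ tau measurable_I01 my).
Qed.

(** The superlevel set on the left is contained in the preimage of the one on the right under
    [(s, u) |-> (s / t, u)]. For [t > 1] that preimage may leave the square, hence only an
    inequality. *)
Lemma distr_fun_tensor_dilation t x y tau : 0 < t -> 0 < tau ->
  measurable_fun I01 x -> measurable_fun I01 y ->
  (n2 (tensor (dilation t x) y) tau <= t%:E * n2 (tensor x y) tau)%E.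
Proof.
move=> t0 tau0 mx my.
have mxy := measurable_tensor x y mx my.
have md := measurable_tensor _ y (measurable_dilation t x mx) my.
have mA := measurable_suplevel _ _ tau measurable_I2 mxy.
rewrite /distr_fun -lebesgue2_dilation//.
apply: (le_measure (mu \x mu)%E); rewrite ?inE.
- exact: (measurable_suplevel _ _ tau measurable_I2 md).
- have mf : measurable_fun setT (fun v : R * R => (v.1 / t, v.2)).
    apply: measurable_fun_pair; last exact: measurable_snd.
    by apply: (measurableT_comp (measurable_divr t)); exact: measurable_fst.
  by rewrite -[X in measurable X]setTI; apply: mf.
move=> [s u] [[/= Is Iu]]; rewrite /tensor/= /dilation indicE.
have [/set_mem Ist|_] := boolP (s / t \in I01); first by rewrite mulr1.
by rewrite mulr0 mul0r normr0 ltNge ltW.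
Qed.

(** Both sides are compared with [m = min(1, t * r)], where [r] is the value for the undilated
    tensor product. The rearrangement exceeds [tau] on []0, r[], so its dilation does so on []0,
    m[]. *)
Lemma distr_fun_tensor_dilation_le t x y tau : 0 < t -> 0 < tau ->
  measurable_fun I01 x -> measurable_fun I01 y ->
  (n2 (tensor (dilation t x) y) tau <=
   n1 (dilation t (rearrangement2 (tensor x y))) tau)%E.
Proof.
move=> t0 tau0 mx my; set w := tensor x y.
have mw : measurable_fun I2 w by exact: measurable_tensor.
have mwr := measurable_rearrangement2 w mw.
have md := measurable_tensor _ y (measurable_dilation t x mx) my.
have [n0 nle] := (distr_fun2_ge0 w tau, distr_fun2_le1 w tau mw).
have nf : (n2 w tau) \is a fin_num by rewrite ge0_fin_numE// (le_lt_trans nle) ?ltry.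
set r := fine (n2 w tau); set m := Num.min 1 (t * r).
have r0 : 0 <= r by exact: fine_ge0.
apply: (@le_trans _ _ m%:E).
  rewrite EFin_min le_min distr_fun2_le1//=.
  by rewrite EFinM /r fineK// distr_fun_tensor_dilation.
apply: (@le_trans _ _ (mu `]0, m[)).
  rewrite lebesgue_measure_itv/= lte_fin oppr0 adde0.
  by case: ltP => //; rewrite lee_fin.
apply: le_measure; rewrite ?inE; [exact: measurable_itv| |].
  exact: (measurable_suplevel _ _ tau measurable_I01 (measurable_dilation t _ mwr)).
rewrite suplevel_dilation// => u /=; rewrite in_itv/= lt_min => /and3P[u0 u1 um].
split; first by rewrite /I01/= in_itv/= !ltW.
apply: suplevel_rearrangement2_itv => //=; rewrite in_itv/= -/r.
by rewrite divr_gt0//= ltr_pdivrMr// mulrC.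
Qed.

(** * Bounds of the dilation on a symmetric space and on its multiplicator *)

Section symmetric_space.
Variable E : symmetric_space R.

Local Notation N := (ss_norm E).
Local Notation one := (cst 1 : R -> R).

Lemma ss_norm_ge0 x : ss_carrier E x -> 0 <= N x.
(* From [x + (-x) = 0 * x] and the triangle inequality, [0 <= 2 * N x]. *)
Proof.
move=> Ex.
have Eopp := ss_scale (-1) Ex.
have Ezero := ss_scale 0 Ex.
have := ss_normD Ex Eopp.
have -> : (fun u => x u + -1 * x u) = (fun u => 0 * x u).
  by apply/funext => u; rewrite mulN1r subrr mul0r.
rewrite !ss_normZ// normr0 mul0r normrN1 mul1r.
by lra.
Qed.

Lemma exists_norm1 : exists2 y, ss_carrier E y & N y = 1.
Proof.
have [y Ey y0] := ss_nonzero E.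
exists (fun u => (N y)^-1 * y u); first exact: ss_scale.
by rewrite ss_normZ// ger0_norm ?mulVf// invr_ge0 ss_norm_ge0.
Qed.

(** Passes from distribution functions to norms: smaller distribution functions give pointwise
    smaller rearrangements, and the ideal property applies to these. *)
Lemma square_space_le z w : measurable_fun I2 z -> square_space E w ->
  (forall tau, 0 < tau -> (n2 z tau <= n2 w tau)%E) ->
  square_space E z /\ square_norm E z <= square_norm E w.
Proof.
move=> mz [mw Ew] zw.
have le_norm (a b : R) : 0 <= a -> a <= b -> `|a| <= `|b|.
  by move=> a0 ab; rewrite !ger0_norm// (le_trans a0).
have zwr u : `|rearrangement2 z u| <= `|rearrangement2 w u|.
  exact (le_norm _ _ (rearrangement2_ge0 z u) (rearrangement2_le z w u mw zw)).
have zwae : {ae mu, forall u : R, I01 u ->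
    `|rearrangement2 z u| <= `|rearrangement2 w u|}.
  by apply: aeW => u _; exact: zwr.
have [Ez le] := ss_ideal Ew (measurable_rearrangement2 z mz) zwae.
by split.
Qed.

Lemma square_space_eq z w : measurable_fun I2 z -> square_space E w ->
  (forall tau, 0 < tau -> n2 z tau = n2 w tau) ->
  square_space E z /\ square_norm E z = square_norm E w.
Proof.
move=> mz Ew zw.
have [|Ez le] := square_space_le z w mz Ew; first by move=> tau /zw ->.
have [|_ le'] := square_space_le w z Ew.1 Ez; first by move=> tau /zw ->.
exact (conj Ez (le_anti (introT andP (conj le le')))).
Qed.

Lemma distr_fun_tensor_one y tau : measurable_fun I01 y -> 0 < tau ->
  n2 (tensor one y) tau = n1 y tau.
Proof.
move=> my tau0; rewrite (distr_fun_tensor_indic I01)//.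
- by rewrite lebesgue_measure_I01 mul1e.
- exact: measurable_I01.
- by move=> s Is; rewrite indicE mem_set.
Qed.

Lemma equimeasurable_tensor_one y : measurable_fun I01 y ->
  equimeasurable (rearrangement2 (tensor one y)) y.
Proof.
move=> my tau tau0; rewrite distr_fun_rearrangement2//.
  exact: distr_fun_tensor_one.
exact: measurable_tensor.
Qed.

(** Tensoring with the constant 1 embeds the space isometrically into the space on the square, so
    that functions of one variable can be compared with functions of two through
    [square_space_le]. *)
Lemma square_space_tensor_one y : ss_carrier E y ->
  square_space E (tensor one y) /\ square_norm E (tensor one y) = N y.
Proof.
move=> Ey; have my := ss_measurable Ey.
have m1y : measurable_fun I2 (tensor one y) by exact: measurable_tensor.
have [] := ss_symmetric Ey (measurable_rearrangement2 _ m1y).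
  exact: equimeasurable_tensor_one.
by split.
Qed.

Lemma square_space_tensor_oneV y : measurable_fun I01 y ->
  square_space E (tensor one y) -> ss_carrier E y.
Proof.
move=> my [_ E1y]; have [] // := ss_symmetric E1y my.
by move=> tau tau0; rewrite equimeasurable_tensor_one.
Qed.

Lemma multiplicator_norm_ub x y : ss_carrier E y -> N y <= 1 ->
  ((square_norm E (tensor x y))%:E <= multiplicator_norm E x)%E.
Proof. by move=> Ey Ny; apply: ereal_sup_ubound; exists y. Qed.

Lemma multiplicator_one : multiplicator E one.
Proof. by split => // y Ey; exact: (square_space_tensor_one y Ey).1. Qed.

Lemma multiplicator_norm_one_le1 : (multiplicator_norm E one <= 1)%E.
Proof.
apply: ge_ereal_sup => _ [y [Ey Ny] <-].
by rewrite lee_fin (square_space_tensor_one y Ey).2.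
Qed.

(** The operator norm is the infimum of these numbers, so inequalities between operator norms reduce
    to statements about individual bounds. An operator that leaves the space has no bound, and its
    norm is [+oo]. *)
Definition space_bound (T : (R -> R) -> R -> R) (C : R) := 0 <= C /\
  forall x, ss_carrier E x -> ss_carrier E (T x) /\
    ((N (T x))%:E <= C%:E * (N x)%:E)%E.

Definition multiplicator_bound (T : (R -> R) -> R -> R) (C : R) := 0 <= C /\
  forall x, multiplicator E x -> multiplicator E (T x) /\
    (multiplicator_norm E (T x) <= C%:E * multiplicator_norm E x)%E.

Lemma multiplicator_bound_dilation t C : 0 < t ->
  space_bound (dilation t) C -> multiplicator_bound (dilation t) C.
Proof.
move=> t0 [C0 hC]; split; first exact C0.
move=> x [mx Mx].
have mdx := measurable_dilation t x mx.
(* The bound [C] is applied to the rearrangement of [tensor x y]. Its dilation, tensored with 1,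
   dominates [tensor (dilation t x) y] in distribution. *)
have key y : ss_carrier E y -> square_space E (tensor (dilation t x) y) /\
    square_norm E (tensor (dilation t x) y) <= C * square_norm E (tensor x y).
  move=> Ey; have my := ss_measurable Ey.
  have [mw Ew] := Mx y Ey.
  have [Edw] := hC _ Ew; rewrite -EFinM lee_fin => Ndw.
  have [S1 S2] := square_space_tensor_one _ Edw.
  have [] := square_space_le (tensor (dilation t x) y) _ _ S1.
  - exact: measurable_tensor.
  - move=> tau tau0; rewrite distr_fun_tensor_one//.
      exact: distr_fun_tensor_dilation_le.
    exact: ss_measurable Edw.
  by rewrite S2 => S3 le; exact (conj S3 (le_trans le Ndw)).
split; first exact (conj mdx (fun y Ey => (key y Ey).1)).
apply: ge_ereal_sup => _ [y [Ey Ny] <-].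
apply: (@le_trans _ _ (C * square_norm E (tensor x y))%:E).
  by rewrite lee_fin (key y Ey).2.
by rewrite EFinM lee_wpmul2l// multiplicator_norm_ub.
Qed.

Lemma dilation_one_indic t : 0 < t <= 1 ->
  forall s : R, I01 s -> dilation t one s = \1_`[0, t] s.
Proof.
move=> /andP[t0 t1] s; rewrite /I01/= in_itv/= => /andP[s0 s1].
rewrite /dilation mul1r !indicE; congr (nat_of_bool _)%:R.
have e : I01 (s / t) <-> `[0, t]%classic s.
  by rewrite /I01/= !in_itv/= s0 divr_ge0 ?(ltW t0)//= ler_pdivrMr// mul1r.
by apply/idP/idP => /set_mem h; apply/mem_set/e.
Qed.

(* Both functions have the distribution function [t * n_y]. *)
Lemma distr_fun_tensor_dilation_one t y tau : 0 < t <= 1 -> 0 < tau ->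
  measurable_fun I01 y ->
  n2 (tensor (dilation t one) y) tau = n2 (tensor one (dilation t y)) tau.
Proof.
move=> t01 tau0 my; have /andP[t0 t1] := t01.
rewrite (distr_fun_tensor_one _ _ (measurable_dilation t y my))//.
rewrite distr_fun_dilation// (distr_fun_tensor_indic `[0, t])//.
- by rewrite lebesgue_measure_itv/= lte_fin t0 oppr0 adde0.
- move=> s; rewrite /I01/= !in_itv/= => /andP[-> st]/=; exact: le_trans t1.
- exact: dilation_one_indic.
Qed.

Lemma space_bound_dilation t C : 0 < t <= 1 ->
  multiplicator_bound (dilation t) C -> space_bound (dilation t) C.
Proof.
move=> t01 [C0 hC].
have [[md Md] Nd] := hC _ multiplicator_one.
have key y : ss_carrier E y -> ss_carrier E (dilation t y) /\
    square_norm E (tensor (dilation t one) y) = N (dilation t y).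
  move=> Ey; have my := ss_measurable Ey.
  have mdy := measurable_dilation t y my.
  have [||S1 S2] := square_space_eq (tensor one (dilation t y)) _ _ (Md y Ey).
    exact: measurable_tensor.
    by move=> tau tau0; rewrite distr_fun_tensor_dilation_one.
  have Edy := square_space_tensor_oneV _ mdy S1; split; first exact Edy.
  by rewrite -S2 (square_space_tensor_one _ Edy).2.
have unit y : ss_carrier E y -> N y <= 1 -> N (dilation t y) <= C.
  move=> Ey Ny; rewrite -(key y Ey).2 -lee_fin.
  apply: le_trans (multiplicator_norm_ub _ _ Ey Ny) _.
  apply: le_trans Nd _; rewrite -[leRHS]mule1.
  by rewrite lee_wpmul2l// multiplicator_norm_one_le1.
split; first exact C0.
move=> y Ey; have [Edy _] := key y Ey; split; first exact Edy.
rewrite -EFinM lee_fin.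
(* Homogeneity: applying [unit] to [a * y] frees [y] from the unit ball. *)
have scaled a : 0 <= a -> a * N y <= 1 -> a * N (dilation t y) <= C.
  move=> a0 aN; have := unit _ (ss_scale a Ey).
  rewrite ss_normZ// (ger0_norm a0) => /(_ aN).
  have -> : dilation t (fun u => a * y u) = (fun u => a * dilation t y u).
    by apply/funext => u; rewrite /dilation mulrA.
  by rewrite ss_normZ// (ger0_norm a0).
have Ny := ss_norm_ge0 y Ey.
have [y0|y0] := eqVneq (N y) 0; last first.
  have Np : 0 < N y by rewrite lt0r y0.
  rewrite -ler_pdivrMr// mulrC; apply: scaled; first by rewrite invr_ge0.
  by rewrite mulVf.
rewrite y0 mulr0 leNgt; apply/negP => d0.
(* If [N y = 0], every multiple of [y] lies in the unit ball. This scalar is chosen so that the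
   dilated multiple has norm [C + 1], which contradicts the bound [C]. *)
have a0 : 0 <= (C + 1) / N (dilation t y).
  by apply: divr_ge0; [exact: addr_ge0|exact: ltW].
have := scaled _ a0; rewrite y0 mulr0 ler01 divfK ?gt_eqF// => /(_ isT).
by lra.
Qed.

Lemma bound_mul_ge1 t C D : 1 < t ->
  multiplicator_bound (dilation t) C -> space_bound (dilation t^-1) D ->
  1 <= C * D.
Proof.
move=> t1 [C0 hC] hD.
have t0 : 0 < t := lt_trans ltr01 t1.
(* [D] is also a bound on the multiplicator, so [C] and [D] can be applied there one after the
   other, starting from the constant 1. *)
have [|D0 hMD] := multiplicator_bound_dilation t^-1 D _ hD.
  by rewrite invr_gt0.
have [Mx Nx] := hMD _ multiplicator_one.
have [[mz Mz] Nz] := hC _ Mx.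
have [y Ey Ny1] := exists_norm1; have my := ss_measurable Ey.
(* Since [t > 1], [s / t] stays in [I01] for [s] in [I01], so neither cut-off is active and the two
   dilations cancel. *)
have zE s : I01 s -> dilation t (dilation t^-1 one) s = \1_I01 s.
  move=> Is; have := Is; rewrite /I01/= in_itv/= => /andP[s0 s1].
  have Ist : I01 (s / t).
    rewrite /I01/= in_itv/= divr_ge0 ?(ltW t0)//= ler_pdivrMr// mul1r.
    exact: le_trans s1 (ltW t1).
  by rewrite /dilation invrK divfK ?gt_eqF// !indicE (mem_set Is) (mem_set Ist) !mulr1.
have [S1 S2] := square_space_tensor_one y Ey.
have [||_ S3] := square_space_eq (tensor (dilation t (dilation t^-1 one)) y) _ _ S1.
- exact: measurable_tensor.
- move=> tau tau0; rewrite distr_fun_tensor_one// (distr_fun_tensor_indic I01)//.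
  + by rewrite lebesgue_measure_I01 mul1e.
  + exact: measurable_I01.
(* The number 1 is rewritten as the norm of the twice dilated constant tensored with the normalised
   [y]. This is at most the multiplicator norm of the first factor, hence at most [C * D]. *)
rewrite -lee_fin -Ny1 -S2 -S3.
apply: le_trans (multiplicator_norm_ub _ _ Ey _) _; first by rewrite Ny1.
apply: (le_trans Nz); rewrite EFinM; apply: lee_wpmul2l.
  by rewrite lee_fin.
apply: (le_trans Nx); rewrite -[leRHS]mule1; apply: lee_wpmul2l.
  by rewrite lee_fin.
exact multiplicator_norm_one_le1.
Qed.

End symmetric_space.
End multiplicator_dilation.

Theorem theorem1p2 (R : realType) (E : symmetric_space R) :
  (forall t : R, 0 < t <= 1 ->
     multiplicator_operator_norm E (dilation t) =
     space_operator_norm E (dilation t)) /\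
  (forall t : R, 1 < t ->
     ((space_operator_norm E (dilation t^-1))^-1
        <= multiplicator_operator_norm E (dilation t)
        <= space_operator_norm E (dilation t))%E).
Proof.
have upper t : 0 < t ->
    (multiplicator_operator_norm E (dilation t) <=
     space_operator_norm E (dilation t))%E.
  move=> t0; apply: le_ereal_inf_tmp => _ [C hC <-].
  apply: ereal_inf_lbound; exists C; last by [].
  exact (multiplicator_bound_dilation E t C t0 hC).
split=> [t t01|t t1].
  apply/eqP; rewrite eq_le upper; last by have /andP[] := t01.
  apply: le_ereal_inf_tmp => _ [C hC <-].
  apply: ereal_inf_lbound; exists C; last by [].
  exact (space_bound_dilation E t C t01 hC).
rewrite upper ?andbT; last exact: lt_trans ltr01 t1.
apply: le_ereal_inf_tmp => _ [C hC <-].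
have C0 : 0 <= C by case: hC.
have S0 : (0 <= space_operator_norm E (dilation t^-1))%E.
  by apply: le_ereal_inf_tmp => _ [D [D0 _] <-]; rewrite lee_fin.
(* Inversion reverses the order on [[0, +oo]], so it remains to bound every [D] below by the inverse
   of [C]. If there is no [D], the infimum is [+oo] and nothing remains to be shown. *)
rewrite inve_ple ?inE//= ?lee_fin//.
apply: le_ereal_inf_tmp => _ [D hD <-].
have CD := bound_mul_ge1 E t C D t1 hC hD.
(* The inverse of 0 is [+oo] in the extended reals, so [C = 0] must be excluded; [1 <= C * D] does
   this. *)
have Cp : 0 < C.
  rewrite lt0r C0 andbT; apply/eqP => C00.
  by move: CD; rewrite C00 mul0r ler10.
by rewrite inver gt_eqF// lee_fin -[C^-1]mul1r ler_pdivrMr// mulrC.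
Qed.
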